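(* Let $k$ be a positive real number and let $(L(t))_{t\ge 0}$ be an $\mathbb{R}^m$-valued Lévy process. (i) If $k$ is an even integer and $\mathbb{E}\|L(1)\|^k<\infty$, then there exist real numbers $m_1,\ldots,m_k$ such that $$\mathbb{E}\|L(t)\|^k=m_1t+\ldots+m_kt^k\quad\text{for all } t\ge 0.$$ (ii) If $\mathbb{E}\|L(1)\|^{(k)_0}<\infty$, then $\mathbb{E}\|L(h)\|^k=O(h^{k/(k)_0})$ as $h\to 0$.
   Context: $\|\cdot\|$ is the Euclidean norm. For a positive real number $\alpha$, $(\alpha)_0$ denotes the smallest even integer greater than or equal to $\alpha$. A Lévy process has stationary independent increments, is continuous in probability and starts at $0$ almost surely. $f(h)=O(g(h))$ means that there is a constant $C$ with $\|f(h)\|\le Cg(h)$ for all $0<h<1$. *)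

(* Defs.v *)
From HB Require Import structures.
From mathcomp Require Import all_boot all_order all_algebra.
From mathcomp Require Import all_classical all_reals all_analysis.

Set Implicit Arguments.
Unset Strict Implicit.
Unset Printing Implicit Defensive.
Import Order.TTheory GRing.Theory Num.Theory.
Import numFieldNormedType.Exports.

Local Open Scope classical_set_scope.
Local Open Scope ring_scope.

(* The library norm on ['rV[R]_m] is the sup norm. *)
Definition enorm (R : realType) (m : nat) (x : 'rV[R]_m) : R :=
  Num.sqrt (\sum_(i < m) x 0 i ^+ 2).

(* R^m with its Borel sigma-algebra; convertible to ['rV[R]_m]. *)
Notation borel_rV R m := (g_sigma_algebraType (@open 'rV[R]_m)).

Definition random_vector d (T : measurableType d) (R : realType) (m : nat)
    (X : T -> 'rV[R]_m) : Prop :=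
  measurable_fun [set: T] (X : T -> borel_rV R m).

Definition same_law d (T : measurableType d) (R : realType)
    (P : probability T R) (m : nat) (X Y : T -> 'rV[R]_m) : Prop :=
  forall A : set (borel_rV R m), measurable A ->
    P (X @^-1` A) = P (Y @^-1` A).

(* Taking some of the [A i] to be the whole space gives the product rule for
   every subfamily. *)
Definition independent_vectors d (T : measurableType d) (R : realType)
    (P : probability T R) (m n : nat) (X : 'I_n -> T -> 'rV[R]_m) : Prop :=
  forall A : 'I_n -> set (borel_rV R m), (forall i, measurable (A i)) ->
    P (\bigcap_(i in [set: 'I_n]) (X i @^-1` A i)) =
    (\prod_(i < n) P (X i @^-1` A i))%E.

(* Only the values of [L] at nonnegative times matter. *)
Record levy_process d (T : measurableType d) (R : realType)
    (P : probability T R) (m : nat) (L : R -> T -> 'rV[R]_m) : Prop := {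
  levy_random_vector : forall t, 0 <= t -> random_vector (L t);
  levy_start : {ae P, forall w, L 0 w = 0};
  levy_independent_increments : forall (n : nat) (t : nat -> R),
    0 <= t 0%N -> (forall i, (i < n)%N -> t i <= t i.+1) ->
    independent_vectors P (fun (i : 'I_n) w => L (t i.+1) w - L (t i) w);
  levy_stationary_increments : forall s t h, 0 <= s -> 0 <= t -> 0 <= h ->
    same_law P (fun w => L (s + h) w - L s w) (fun w => L (t + h) w - L t w);
  levy_continuous_in_probability : forall t e, 0 <= t -> 0 < e ->
    P [set w | e < enorm (L s w - L t w)]
      @[s --> within `[0, +oo[ (nbhs t)] --> 0%E
}.

Definition norm_moment d (T : measurableType d) (R : realType)
    (P : probability T R) (m : nat) (X : T -> 'rV[R]_m) (p : R) : \bar R :=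
  ('E_P[(fun w => enorm (X w) `^ p)%R])%E.

Lemma exists_even_ge (R : realType) (a : R) :
  exists n : nat, ~~ odd n && (a <= n%:R).
Proof.
exists (Num.bound a).*2; rewrite odd_double /=.
apply: (le_trans (ler_norm a)); apply: (le_trans (ltW (archi_boundP _))) => //.
rewrite (_ : Num.bound `|a| = Num.bound a); last by rewrite /Num.bound normr_id.
by rewrite ler_nat -addnn leq_addr.
Qed.

(* The smallest even integer [>= a]; for [a > 0] it is positive, so searching
   in [nat] loses nothing. *)
Definition even_ceil (R : realType) (a : R) : nat := ex_minn (exists_even_ge a).

(* [f(h) = O(g(h))] as [h -> 0], with the bound required on all of (0, 1). *)
Definition bigO_unit (R : realType) (f : R -> \bar R) (g : R -> R) : Prop :=
  exists C : R, forall h, 0 < h < 1 -> (`|f h| <= (C * g h)%:E)%E.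

(* Main.v *)
From HB Require Import structures.
Require Import Defs.
From mathcomp Require Import all_boot all_order all_algebra.
From mathcomp Require Import all_classical all_reals all_analysis.
From mathcomp Require Import measurable_realfun ring lra.
Set Implicit Arguments.
Unset Strict Implicit.
Unset Printing Implicit Defensive.
Import Order.TTheory GRing.Theory Num.Theory.
Import numFieldNormedType.Exports.

Local Open Scope classical_set_scope.
Local Open Scope ring_scope.

(* The laws [mu t] of [L t] form a convolution semigroup, so that
   [E f(L(t+h)) - E f(L(t)) = E g(L(t))] with
   [g x = \int (f (x + y) - f x) dmu_h(y)].  Taking an increment of [f] lowers
   its polynomial degree, measured by the number of differences needed to reach
   [0]; hence for [f = ||.||^(2q)], of degree [2q], all [(2q+1)]-fold
   differences of [t |-> E ||L(t)||^(2q)] vanish on [t >= 0].  By Frechet's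
   theorem this function is a polynomial as soon as it is locally bounded.
   Local boundedness follows from independence of increments: by stochastic
   continuity an increment over a short time is of norm at most [1] with
   probability at least [1/2], so a moment at time [t + h] controls the moment
   at time [t].  Part (ii) integrates the pointwise bound
   [a^k <= h^(k/n) (1 + a^n / h)]. *)

(** * Functions of bounded difference degree *)

(** Polynomials of degree less than [n] in Fréchet's sense, with base points and steps in [D]. One
    notion serves both R^m and the half-line of times, where steps cannot be negative. *)
Fixpoint fdeg_lt {R : zmodType} {X : Type} (D : set X) (op : X -> X -> X)
    (n : nat) (f : X -> R) : Prop :=
  if n is n'.+1 then
    forall h, D h -> fdeg_lt D op n' (fun x => f (op x h) - f x)
  else forall x, D x -> f x = 0.

Section fdeg_lt_theory.
Context {R : comPzRingType} {X : Type} (D : set X) (op : X -> X -> X).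
Hypothesis D_op : forall x y, D x -> D y -> D (op x y).

Notation dlt := (fdeg_lt D op).

Lemma fdeg_lt_ext n (f g : X -> R) :
  (forall x, D x -> f x = g x) -> dlt n f -> dlt n g.
Proof.
elim: n f g => [|n IHn] f g fg /= df; first by move=> x Dx; rewrite -fg ?df.
move=> h Dh; apply: IHn (df h Dh) => x Dx.
by rewrite !fg //; apply: D_op.
Qed.

Lemma fdeg_lt_zero n (f : X -> R) : (forall x, D x -> f x = 0) -> dlt n f.
Proof.
elim: n f => [//|n IHn] f f0 h Dh; apply: IHn => x Dx.
by rewrite !f0 ?subrr //; apply: D_op.
Qed.

Lemma fdeg_ltS n (f : X -> R) : dlt n f -> dlt n.+1 f.
Proof.
elim: n f => [|n IHn] f df h Dh; first exact: (@fdeg_lt_zero 1 _ df).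
by apply: IHn; apply: df.
Qed.

Lemma fdeg_lt_leq n k (f : X -> R) : (n <= k)%N -> dlt n f -> dlt k f.
Proof.
move=> /subnKC <-; elim: (k - n)%N => [|j IHj] df; first by rewrite addn0.
by rewrite addnS; apply/fdeg_ltS/IHj.
Qed.

Lemma fdeg_lt_cst (c : R) : dlt 1 (fun=> c).
Proof. by move=> h Dh x Dx; rewrite subrr. Qed.

Lemma fdeg_ltD n (f g : X -> R) :
  dlt n f -> dlt n g -> dlt n (fun x => f x + g x).
Proof.
elim: n f g => [|n IHn] f g df dg /=.
  by move=> x Dx; rewrite df // dg // addr0.
move=> h Dh; apply: fdeg_lt_ext (IHn _ _ (df h Dh) (dg h Dh)) => x _.
by ring.
Qed.

(** Leibniz rule: with [f'] and [g'] the first differences, that of the product is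
    [f' g + f' g' + f g'], and each term has a smaller total order. As [a] and [b] are strict degree
    bounds, the product gets the strict bound [a + b - 1]. *)
Lemma fdeg_ltM n a b (f g : X -> R) : (a + b <= n.+1)%N ->
  dlt a f -> dlt b g -> dlt n (fun x => f x * g x).
Proof.
elim: n a b f g => [|n IHn] [|a] [|b] f g abn df dg;
  try (by apply: fdeg_lt_zero => x Dx; rewrite df // mul0r);
  try (by apply: fdeg_lt_zero => x Dx; rewrite dg // mulr0).
  by rewrite addSn addnS in abn.
move: abn; rewrite addSn addnS ltnS => abn.
move=> h Dh; pose f' x := f (op x h) - f x; pose g' x := g (op x h) - g x.
have d1 : dlt n (fun x => f' x * g x).
  by apply: (IHn a b.+1) => //; [rewrite addnS | apply: df].
have d2 : dlt n (fun x => f' x * g' x).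
  by apply: (IHn a b); [apply: ltnW | apply: df | apply: dg].
have d3 : dlt n (fun x => f x * g' x).
  by apply: (IHn a.+1 b) => //; apply: dg.
apply: fdeg_lt_ext (fdeg_ltD (fdeg_ltD d1 d2) d3) => x _.
by rewrite /f' /g'; ring.
Qed.

Lemma fdeg_lt_exp a (f : X -> R) p :
  dlt a.+1 f -> dlt (a * p).+1 (fun x => f x ^+ p).
Proof.
move=> df; elim: p => [|p IHp]; first by rewrite muln0; apply: fdeg_lt_cst.
apply: fdeg_lt_ext (@fdeg_ltM (a * p.+1).+1 _ _ _ _ _ df IHp) => [x _|].
  by rewrite exprS.
by rewrite mulnS !addSn addnS.
Qed.

Lemma fdeg_lt_sum (I : Type) (r : seq I) n (f : I -> X -> R) :
  (forall i, dlt n (f i)) -> dlt n (fun x => \sum_(i <- r) f i x).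
Proof.
move=> df; elim: r => [|i r IHr].
  by apply: fdeg_lt_zero => x _; rewrite big_nil.
apply: fdeg_lt_ext (fdeg_ltD (df i) IHr) => x _.
by rewrite big_cons.
Qed.

End fdeg_lt_theory.

(** * Frechet's functional equation on the half-line *)

Section frechet.
Context {R : realType}.
Notation nneg := [set t : R | 0 <= t].
Notation dlt := (fdeg_lt nneg (fun t h : R => t + h)).

Lemma nneg_add (x y : R) : nneg x -> nneg y -> nneg (x + y).
Proof. exact: addr_ge0. Qed.

Lemma fdeg_lt_horner n (p : {poly R}) :
  (size p <= n)%N -> dlt n (fun t => p.[t]).
Proof.
move=> pn; apply: (fdeg_lt_leq nneg_add pn).
have dX : dlt 2 (fun t : R => t).
  move=> h _; apply: (fdeg_lt_ext nneg_add _ (@fdeg_lt_cst _ _ _ _ h)) => x _.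
  by rewrite addrC addKr.
apply: (@fdeg_lt_ext _ _ _ _ nneg_add _
  (fun t => \sum_(i < size p) p`_i * t ^+ i)) => [t _|].
  by rewrite horner_coef.
apply: (fdeg_lt_sum nneg_add) => i.
apply: (@fdeg_lt_leq _ _ _ _ nneg_add i.+1) => //.
apply: (@fdeg_ltM _ _ _ _ nneg_add _ 1 i.+1) => //; first exact: fdeg_lt_cst.
by have := fdeg_lt_exp nneg_add i dX; rewrite mul1n.
Qed.

Lemma mulrn_bounded_eq0 (c C : R) : (forall j, `|c *+ j| <= C) -> c = 0.
Proof.
move=> cC; apply/eqP; apply: contraT => c0.
have c0' : 0 < `|c| by rewrite normr_gt0.
have := cC (Num.bound `|C / `|c| |).
rewrite normrMn -mulr_natr leNgt => /negP; case.
rewrite mulrC -ltr_pdivrMr // (le_lt_trans (ler_norm _)) // archi_boundP //.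
Qed.

(** For fixed [t] the difference of [g] with step [t] is bounded and of lower degree, hence a
    constant [c] by induction. So [g] is affine along the multiples of [t], and boundedness forces
    [c = 0]. *)
Lemma fdeg_lt_bounded n (g : R -> R) : dlt n g ->
  (exists C, forall t, 0 <= t -> `|g t| <= C) ->
  forall t, 0 <= t -> g t = g 0.
Proof.
elim: n g => [|n IHn] g dg [C gC] t t0; first by rewrite !dg //=.
pose c := g t - g 0.
have cE s : 0 <= s -> g (s + t) - g s = c.
  move=> s0; have := IHn _ (dg t t0) _ s s0; rewrite add0r => -> //.
  exists (C + C) => u u0; apply: le_trans (ler_normB _ _) _.
  by rewrite lerD // gC // addr_ge0.
have gj j : g (t *+ j) = g 0 + c *+ j.
  elim: j => [|j IHj]; first by rewrite !mulr0n addr0.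
  rewrite mulrSr -[LHS](subrK (g (t *+ j))) cE ?mulrn_wge0 // IHj mulrSr.
  by rewrite addrC -addrA.
suff : c = 0 by move/eqP; rewrite subr_eq0 => /eqP.
apply: (@mulrn_bounded_eq0 _ (C + C)) => j.
have -> : c *+ j = g (t *+ j) - g 0 by rewrite gj addrC addKr.
by apply: le_trans (ler_normB _ _) _; rewrite lerD // gC // mulrn_wge0.
Qed.

Definition locally_bounded (g : R -> R) :=
  forall M, exists C, forall t, 0 <= t <= M -> `|g t| <= C.

(* Differencing with step 1 shows by induction that such a [g] is 1-periodic,
   hence bounded. *)
Lemma fdeg_lt_eq0 n (g : R -> R) : dlt n g -> locally_bounded g ->
  (forall i, (i < n)%N -> g i%:R = 0) -> forall t, 0 <= t -> g t = 0.
Proof.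
elim: n g => [|n IHn] g dg gb g0 t t0; first exact: dg.
have per s : 0 <= s -> g (s + 1) = g s.
  move=> s0; apply/eqP; rewrite -subr_eq0; apply/eqP.
  apply: (IHn (fun u => g (u + 1) - g u)) => //.
  - by apply: dg; rewrite /= ler01.
  - move=> M; have [C gC] := gb (M + 1); exists (C + C) => u /andP[u0 uM].
    apply: le_trans (ler_normB _ _) _.
    by rewrite lerD // gC; lra.
  - by move=> i ni; rewrite natr1 !g0 ?subrr // ltnW.
have perj j s : 0 <= s -> g (s + j%:R) = g s.
  move=> s0; elim: j => [|j IHj]; first by rewrite addr0.
  by rewrite -natr1 addrA per // addr_ge0.
rewrite (@fdeg_lt_bounded n.+1) //; first exact: (g0 0).
have [C gC] := gb 1; exists C => s s0.
have /andP[s1 s2] := truncn_itv s0.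
rewrite -[s](subrK (Num.truncn s)%:R) perj ?subr_ge0 // gC //.
by rewrite subr_ge0 s1 lerBlDr addrC natr1 ltW.
Qed.

(** Newton's scheme: a multiple of [q], which vanishes at the old nodes, corrects the value at the
    new one. *)
Lemma interpolation (g : R -> R) n : exists2 p : {poly R},
  (size p <= n)%N & forall i, (i < n)%N -> p.[i%:R] = g i%:R.
Proof.
elim: n => [|n [p pn pE]]; first by exists 0; rewrite ?size_poly0.
pose q : {poly R} := \prod_(i < n) ('X - (i%:R)%:P).
have qn : q.[n%:R] != 0.
  rewrite horner_prod prodf_seq_neq0; apply/allP => i _ /=.
  by rewrite hornerXsubC subr_eq0 eqr_nat gtn_eqF.
exists (p + ((g n%:R - p.[n%:R]) / q.[n%:R]) *: q) => [|i].
  apply: leq_trans (size_polyD _ _) _; rewrite geq_max leqW //=.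
  apply: leq_trans (size_scale_leq _ _) _.
  by rewrite size_prod_XsubC -[index_enum _]enumT size_enum_ord.
rewrite ltnS leq_eqVlt hornerD hornerZ => /predU1P[->|ni].
  by rewrite divfK // addrC subrK.
suff -> : q.[i%:R] = 0 by rewrite mulr0 addr0 pE.
rewrite horner_prod (bigD1 (Ordinal ni)) //=.
by rewrite hornerXsubC subrr mul0r.
Qed.

(** Subtracting the interpolant at the first [n] integers leaves a locally bounded function with the
    same degree bound and [n] zeros, to which [fdeg_lt_eq0] applies. *)
Lemma frechet_polynomial n (g : R -> R) : dlt n g -> locally_bounded g ->
  exists2 p : {poly R}, (size p <= n)%N & forall t, 0 <= t -> g t = p.[t].
Proof.
move=> dg gb; have [p pn pE] := interpolation g n; exists p => // t t0.
apply/eqP; rewrite -subr_eq0; apply/eqP.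
apply: (@fdeg_lt_eq0 n (fun s => g s - p.[s])) => //.
- apply: (fdeg_lt_ext nneg_add _ (fdeg_ltD nneg_add dg
    (@fdeg_lt_horner n (- p) _))) => [s _|].
    by rewrite hornerN.
  by rewrite size_polyN.
- move=> M; have [C gC] := gb M.
  exists (C + \sum_(i < size p) `|p`_i| * M ^+ i) => s /andP[s0 sM].
  apply: le_trans (ler_normB _ _) _; rewrite lerD // ?gC ?s0 //.
  rewrite horner_coef; apply: le_trans (ler_norm_sum _ _ _) _.
  apply: ler_sum => i _; rewrite normrM normrX (ger0_norm s0).
  by rewrite ler_wpM2l // lerXn2r // nnegrE (le_trans s0).
- by move=> i ni; rewrite pE // subrr.
Qed.

End frechet.

(** * The Borel sigma-algebra of R^m *)

Section borel_rV.
Context {R : realType} {m : nat}.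

Lemma measurable_coord (i : 'I_m) :
  measurable_fun [set: borel_rV R m] (fun x : 'rV[R]_m => x 0 i).
Proof.
apply: (measurability (@RGenOInfty.G R)); first exact: RGenOInfty.measurableE.
move=> _ [_ [a ->] <-]; rewrite setTI; apply: sub_sigma_algebra.
have /continuousP := @coord_continuous R 1 m 0 i; apply.
exact: rray_open.
Qed.

(** Rational centres and radii [1/(q.2 + 1)] make this base of the topology countable. *)
Definition rat_box (q : 'rV[rat]_m * nat) : set 'rV[R]_m :=
  [set x | forall i, `|x 0 i - ratr (q.1 0 i)| < q.2.+1%:R^-1].

Lemma open_bigcup_rat_box (U : set 'rV[R]_m) : open U ->
  U = \bigcup_q (if `[< rat_box q `<=` U >] then rat_box q else set0).
Proof.
move=> oU; apply/seteqP; split; last first.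
  by move=> x [q _]; case: asboolP => // qU /qU.
move=> x Ux; have /nbhs_ballP[e /= e0 eU] := open_nbhs_nbhs (conj oU Ux).
(* Two points of a box of radius [1/(n+1)] differ by less than [2/(n+1) < e] in each coordinate, so
   such a box around [x] lies in the [e]-ball. *)
pose n := Num.bound (2 / e).
have n0 : (0 : R) < n.+1%:R^-1 by rewrite invr_gt0.
have ne : n.+1%:R^-1 + n.+1%:R^-1 < e.
  rewrite -mulr2n -[_ *+ 2]mulr_natl ltr_pdivrMr // -ltr_pdivrMl // mulrC.
  rewrite (lt_le_trans (archi_boundP _)) ?divr_ge0 ?(ltW e0) //.
  by rewrite ler_nat leqnSn.
have /choice[q qE] : forall i : 'I_m, exists q : rat,
    `|x 0 i - ratr q| < n.+1%:R^-1.
  move=> i; have : x 0 i - n.+1%:R^-1 < x 0 i + n.+1%:R^-1.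
    by rewrite ltrBlDr -addrA ltrDl addr_gt0.
  move=> /rat_in_itvoo[q /itvP qE]; exists q.
  by rewrite distrC ltr_distl !qE.
pose Q : 'rV[rat]_m := \row_i q i.
have xQ : rat_box (Q, n) x by move=> i; rewrite mxE.
exists (Q, n) => //; case: asboolP => // -[] y yQ; apply: eU; split => // i j.
rewrite ord1 /ball /= (le_lt_trans _ ne) //.
rewrite -(subrK (ratr (Q 0 j)) (x 0 j)) -addrA (le_trans (ler_normD _ _)) //.
rewrite lerD // ltW //.
by rewrite distrC; apply: yQ.
Qed.

(** An open set is a countable union of rational boxes, and the preimage of a box is a finite
    intersection of conditions on coordinates. *)
Lemma measurable_fun_coord d (T : measurableType d) (f : T -> 'rV[R]_m) :
  (forall i, measurable_fun [set: T] (fun w => f w 0 i)) ->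
  measurable_fun [set: T] (f : T -> borel_rV R m).
Proof.
move=> mf; apply: (@measurability _ _ T (borel_rV R m) setT f (@open 'rV[R]_m)).
  by [].
move=> _ [U oU <-]; rewrite setTI (open_bigcup_rat_box oU) preimage_bigcup.
apply: countable_bigcupT_measurable => [|q]; first exact: countableP.
case: asboolP => _; last by rewrite preimage_set0.
rewrite (_ : _ @^-1` _ = \bigcap_(i in [set: 'I_m])
    ((fun w => f w 0 i) @^-1` ball (ratr (q.1 0 i) : R) q.2.+1%:R^-1)).
  apply: fin_bigcap_measurable => // i _; rewrite -[X in measurable X]setTI.
  by apply: mf => //; apply: measurable_ball.
apply/seteqP; split=> w /= H i.
  by move=> _; rewrite /ball /= distrC; apply: H.
by rewrite distrC; apply: (H i I).
Qed.

(** The domain carries the product of the two Borel sigma-algebras, on which products of laws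
    live. *)
Lemma measurable_addV : measurable_fun [set: borel_rV R m * borel_rV R m]
  ((fun z => (z.1 + z.2 : 'rV[R]_m)) : _ -> borel_rV R m).
Proof.
apply: measurable_fun_coord => i.
apply: (eq_measurable_fun (fun z : borel_rV R m * borel_rV R m =>
   ((z.1 : 'rV[R]_m) 0 i + (z.2 : 'rV[R]_m) 0 i))) => [z _|].
  by rewrite mxE.
by apply: measurable_funD; apply: measurableT_comp (measurable_coord i) _.
Qed.

Lemma measurable_subV d (T : measurableType d) (X Y : T -> 'rV[R]_m) :
  random_vector X -> random_vector Y -> random_vector (fun w => X w - Y w).
Proof.
move=> mX mY; apply: measurable_fun_coord => i.
apply: (eq_measurable_fun (fun w => X w 0 i - Y w 0 i)) => [w _|].
  by rewrite !mxE.
apply: measurable_funB.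
  exact: measurableT_comp (measurable_coord i) mX.
exact: measurableT_comp (measurable_coord i) mY.
Qed.

(** The square of [enorm], without the root, so that it is polynomial in the coordinates. *)
Definition sqnorm (x : 'rV[R]_m) : R := \sum_(i < m) x 0 i ^+ 2.

Lemma measurable_sqnorm : measurable_fun [set: borel_rV R m] sqnorm.
Proof.
apply: measurable_sum => i; apply: measurable_funX; exact: measurable_coord.
Qed.

Lemma sqnorm_ge0 x : 0 <= sqnorm x.
Proof. by apply: sumr_ge0 => i _; apply: sqr_ge0. Qed.

Lemma sqnorm_add x y : sqnorm (x + y) <= 2 * sqnorm x + 2 * sqnorm y.
Proof.
rewrite /sqnorm !mulr_sumr -big_split /=; apply: ler_sum => i _.
rewrite mxE -subr_ge0; set a := x 0 i; set b := y 0 i.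
by have -> : 2 * a ^+ 2 + 2 * b ^+ 2 - (a + b) ^+ 2 = (a - b) ^+ 2;
  [ring | apply: sqr_ge0].
Qed.

Lemma sqnorm_sub x y : sqnorm x <= 2 * sqnorm (x + y) + 2 * sqnorm y.
Proof.
have := sqnorm_add (x + y) (- y); rewrite addrK.
rewrite [sqnorm (- y)](eq_bigr (fun i => y 0 i ^+ 2)) // => i _.
by rewrite mxE sqrrN.
Qed.

End borel_rV.

(** * Moments along a convolution semigroup *)

Lemma integral_prob_cst {d} {T : measurableType d} {R : realType}
  (P : probability T R) (c : \bar R) : (\int[P]_x c = c)%E.
Proof. by rewrite integral_cst //= probability_setT mule1. Qed.

Lemma Rintegral_prob_cst {d} {T : measurableType d} {R : realType}
  (P : probability T R) (c : R) : \int[P]_x c = c.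
Proof. by rewrite /Rintegral integral_prob_cst. Qed.

Lemma add1_le_mul {R : realDomainType} (a b c k : R) :
  0 <= a -> 0 <= b -> 0 <= k -> c <= k * (a + b) ->
  1 + c <= (1 + k * a + k) * (1 + b).
Proof.
by move=> a0 b0 k0 ck; have := mulr_ge0 (mulr_ge0 k0 a0) b0; lra.
Qed.

Section convolution_semigroup.
Context {R : realType} {dV : measure_display} {V : measurableType dV}.
Variables (op : V -> V -> V) (mu : R -> probability V R) (w : V -> R) (K : R).
Notation uop := (fun z : V * V => op z.1 z.2).
Hypothesis measurable_op : measurable_fun [set: V * V] uop.
Hypothesis mu_conv : forall s h : R, 0 <= s -> 0 <= h ->
  forall A, measurable A ->
    mu (s + h) A = ((mu s \x mu h)%E) (uop @^-1` A).
Hypothesis measurable_w : measurable_fun [set: V] w.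
Hypothesis w_ge0 : forall x, 0 <= w x.
Hypothesis K_ge0 : 0 <= K.
Hypothesis w_op : forall x y, w (op x y) <= K * (w x + w y).

Local Open Scope ereal_scope.

Lemma conv_tonelli (s h : R) (f : V -> \bar R) : (0 <= s)%R -> (0 <= h)%R ->
  measurable_fun [set: V] f -> (forall x, 0 <= f x) ->
  \int[mu (s + h)]_x f x = \int[mu s]_x \int[mu h]_y f (op x y).
Proof.
move=> s0 h0 mf f0.
rewrite (eq_measure_integral (pushforward (mu s \x mu h) uop)); last first.
  by move=> A mA _; exact: mu_conv.
rewrite ge0_integral_pushforward // preimage_setT.
rewrite fubini_tonelli1 //; last by move=> z; exact: f0.
exact: measurableT_comp.
Qed.

(** For a Lévy process [w] will be an even power of the norm. Values are extended reals because
    finiteness is at first known at time 1 only. *)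
Definition wmoment (t : R) : \bar R := \int[mu t]_x (w x)%:E.

Lemma measurable_op2 x : measurable_fun [set: V] (op x).
Proof.
exact: (measurableT_comp (f := uop) measurable_op (measurable_pair1 x)).
Qed.

Lemma measurable_w_op x : measurable_fun [set: V] (fun y => (w (op x y))%:E).
Proof.
apply/measurable_EFinP; apply: measurableT_comp measurable_w _.
exact: measurable_op2.
Qed.

Lemma measurable_Ew : measurable_fun [set: V] (fun y => (w y)%:E).
Proof. exact/measurable_EFinP. Qed.

Lemma measurable_w_conv h :
  measurable_fun [set: V] (fun x => \int[mu h]_y (w (op x y))%:E).
Proof.
apply: (@measurable_fun_fubini_tonelli_F _ _ _ _ _ (mu h)
  (fun z => (w (uop z))%:E)).
  by apply/measurable_EFinP; apply: measurableT_comp measurable_w measurable_op.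
by move=> z; rewrite lee_fin.
Qed.

Lemma wmoment_ge0 t : 0 <= wmoment t.
Proof. by apply: integral_ge0 => x _; rewrite lee_fin. Qed.

(** This is [w_op] integrated against two probability laws; it carries bounds forward in time. *)
Lemma wmoment_add (s h : R) : (0 <= s)%R -> (0 <= h)%R ->
  wmoment (s + h) <= K%:E * (wmoment s + wmoment h).
Proof.
move=> s0 h0.
rewrite {1}/wmoment conv_tonelli //; last exact: measurable_Ew.
have inner x : \int[mu h]_y (w (op x y))%:E <= K%:E * ((w x)%:E + wmoment h).
  apply: (@le_trans _ _ (\int[mu h]_y (K%:E * ((w x)%:E + (w y)%:E)))).
    apply: ge0_le_integral => //.
    - by move=> y _; rewrite lee_fin.
    - exact: measurable_w_op.
    - apply/measurable_EFinP; apply: measurable_funM => //.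
      exact: measurable_funD.
    - by move=> y _; rewrite -EFinD -EFinM lee_fin.
  rewrite ge0_integralZl_EFin //; last 2 first.
  - by move=> y _; rewrite -EFinD lee_fin addr_ge0.
  - by apply/measurable_EFinP; exact: measurable_funD.
  rewrite ge0_integralD //; last 3 first.
  - by move=> y _; rewrite lee_fin.
  - by move=> y _; rewrite lee_fin.
  - exact: measurable_Ew.
  by rewrite integral_prob_cst.
apply: (@le_trans _ _ (\int[mu s]_x (K%:E * ((w x)%:E + wmoment h)))).
  apply: ge0_le_integral => //.
  - by move=> x _; apply: integral_ge0 => y _; rewrite lee_fin.
  - exact: measurable_w_conv.
  - apply: measurable_funeM; apply: emeasurable_funD => //.
    exact: measurable_Ew.
rewrite ge0_integralZl_EFin //; last 2 first.
- by move=> x _; rewrite adde_ge0 ?wmoment_ge0 // lee_fin.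
- by apply: emeasurable_funD => //; exact: measurable_Ew.
rewrite ge0_integralD //; last 3 first.
- by move=> x _; rewrite lee_fin.
- exact: measurable_Ew.
- by move=> x _; exact: wmoment_ge0.
by rewrite integral_prob_cst.
Qed.

(** * Local boundedness from one finite moment *)

Section wmoment_bounded.
Variables (B : set V) (delta : R).
Hypothesis measurable_B : measurable B.
Hypothesis w_opB : forall x y, B y -> (w x <= K * (w (op x y) + 1))%R.
Hypothesis delta_gt0 : (0 < delta)%R.
Hypothesis mu_B : forall h : R, (0 <= h <= delta)%R -> (2^-1)%:E <= mu h B.

(** For [y] in [B], [w x] is controlled by [w (op x y)]. Integrating over [y] in [B], of mass at
    least 1/2, costs a factor 2; integrating over [x] then bounds a moment by a later one. *)
Lemma wmoment_back (t h : R) : (0 <= t)%R -> (0 <= h <= delta)%R ->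
  wmoment t <= (2 * K)%:E * (wmoment (t + h) + 1).
Proof.
move=> t0 hd; have /andP[h0 _] := hd.
rewrite {2}/wmoment conv_tonelli //; last exact: measurable_Ew.
have J0 x : 0 <= \int[mu h]_y (w (op x y))%:E.
  by apply: integral_ge0 => y _; rewrite lee_fin.
have inner x : (w x)%:E <= (2 * K)%:E * (\int[mu h]_y (w (op x y))%:E + 1).
  have : (w x)%:E * (2^-1)%:E <= K%:E * (\int[mu h]_y (w (op x y))%:E + 1).
    apply: (@le_trans _ _ (\int[mu h]_(y in B) (w x)%:E)).
      by rewrite integral_cst // lee_wpmul2l ?lee_fin // mu_B.
    apply: (@le_trans _ _ (\int[mu h]_(y in B) (K%:E * ((w (op x y))%:E + 1)))).
      apply: ge0_le_integral => //.
      - by move=> y _; rewrite lee_fin.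
      - apply: measurable_funTS; apply: measurable_funeM.
        by apply: emeasurable_funD => //; exact: measurable_w_op.
      - by move=> y By; rewrite -EFinD -EFinM lee_fin w_opB.
    apply: (@le_trans _ _ (\int[mu h]_y (K%:E * ((w (op x y))%:E + 1)))).
      apply: ge0_subset_integral => //.
        apply: measurable_funeM.
        by apply: emeasurable_funD => //; exact: measurable_w_op.
      by move=> y _; rewrite -EFinD -EFinM lee_fin mulr_ge0 // addr_ge0.
    rewrite ge0_integralZl_EFin //; last 2 first.
    - by move=> y _; rewrite -EFinD lee_fin addr_ge0.
    - by apply: emeasurable_funD => //; exact: measurable_w_op.
    rewrite ge0_integralD //; last 2 first.
    - by move=> y _; rewrite lee_fin.
    - exact: measurable_w_op.
    by rewrite integral_prob_cst.
  move=> wK; have -> : (w x)%:E = 2%:E * ((w x)%:E * (2^-1)%:E).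
    by rewrite -!EFinM; congr EFin; field.
  by rewrite EFinM -muleA lee_wpmul2l // lee_fin.
apply: (@le_trans _ _
  (\int[mu t]_x ((2 * K)%:E * (\int[mu h]_y (w (op x y))%:E + 1)))).
  apply: ge0_le_integral => //.
  - by move=> x _; rewrite lee_fin.
  - exact: measurable_Ew.
  - apply: measurable_funeM; apply: emeasurable_funD => //.
    exact: measurable_w_conv.
rewrite ge0_integralZl_EFin //; last 3 first.
- by move=> x _; rewrite adde_ge0.
- by apply: emeasurable_funD => //; exact: measurable_w_conv.
- by rewrite mulr_ge0.
rewrite ge0_integralD //; last exact: measurable_w_conv.
by rewrite integral_prob_cst.
Qed.

Lemma wmoment_locally_bounded : wmoment 1 < +oo ->
  forall M : R, exists C : R,
    forall t : R, (0 <= t <= M)%R -> wmoment t <= C%:E.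
Proof.
move=> W1.
(* The constant depends on the number [j] of steps up to time 1, but not on [t] or [h]. *)
have back j : exists C : R, forall t h : R, (0 <= t)%R -> (0 <= h <= delta)%R ->
    (t + h * j%:R = 1)%R -> wmoment t <= C%:E.
  elim: j => [|j [C IHj]].
    exists (fine (wmoment 1)) => t h _ _; rewrite mulr0 addr0 => ->.
    by rewrite fineK // ge0_fin_numE // wmoment_ge0.
  exists (2 * K * (C + 1))%R => t h t0 hd th; have /andP[h0 _] := hd.
  apply: le_trans (wmoment_back t0 hd) _.
  rewrite (EFinM (2 * K)%R) EFinD lee_wpmul2l ?lee_fin ?mulr_ge0 // leeD2r //.
  apply: (IHj _ h) => //; first exact: addr_ge0.
  by rewrite -[RHS]th -natr1 -addrA mulrDr mulr1 [(h + _)%R]addrC.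
have [C1 W01] : exists C : R,
    forall t : R, (0 <= t <= 1)%R -> wmoment t <= C%:E.
  (* [N] exceeds [1/delta], so [N] equal steps of length at most [delta] lead from any [t] in [0, 1]
     to 1. *)
  pose N := (Num.bound delta^-1).+1; have [C WC] := back N.
  exists C => t /andP[t0 t1]; apply: (WC t ((1 - t) / N%:R)%R) => //.
    rewrite divr_ge0 ?subr_ge0 //= ler_pdivrMr // (@le_trans _ _ 1%R) //.
      by rewrite gerBl.
    rewrite -ler_pdivrMl // mulr1 ltW // (lt_le_trans (archi_boundP _)) //.
      by rewrite invr_ge0 ltW.
    by rewrite ler_nat leqnSn.
  by rewrite divfK ?pnatr_eq0 // addrC subrK.
(* Times beyond 1 are reached from 0 by [j] equal steps of length at most 1. *)
have up j : exists C : R, forall x : R, (0 <= x <= 1)%R ->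
    wmoment (x * j%:R) <= C%:E.
  elim: j => [|j [C IHj]].
    by exists C1 => x _; rewrite mulr0 W01 // lexx ler01.
  exists (K * (C + C1))%R => x x01; have /andP[x0 _] := x01.
  rewrite -natr1 mulrDr mulr1; apply: le_trans (wmoment_add _ _) _ => //.
    exact: mulr_ge0.
  by rewrite EFinM EFinD lee_wpmul2l ?lee_fin // leeD // ?IHj ?W01.
move=> M; pose N := (Num.bound M).+1; have [C WC] := up N.
exists C => t /andP[t0 tM].
rewrite -[t](@divfK _ N%:R) ?pnatr_eq0 //; apply: WC.
rewrite divr_ge0 //= ler_pdivrMr // mul1r (le_trans tM) // ltW //.
rewrite (lt_le_trans (archi_boundP _)) ?(le_trans t0) //.
by rewrite ler_nat leqnSn.
Qed.

End wmoment_bounded.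

(** * Expectations of functions dominated by the weight *)

Section polynomial_moments.
Hypothesis w_fin : forall t : R, (0 <= t)%R -> wmoment t < +oo.

Local Open Scope ring_scope.

(** A class of signed functions with finite expectations that is stable under translation,
    subtraction and averaging, so that differences can be iterated inside it. *)
Definition w_dominated (f : V -> R) :=
  measurable_fun [set: V] f /\
  exists2 C : R, 0 <= C & forall x, `|f x| <= C * (1 + w x).

Lemma w_dominated_integrable f t : w_dominated f -> 0 <= t ->
  (mu t).-integrable [set: V] (EFin \o f).
Proof.
move=> [mf [C C0 fC]] t0.
apply: (@le_integrable _ _ _ _ _ measurableT _ (fun x => (C * (1 + w x))%:E)).
- exact/measurable_EFinP.
- move=> x _ /=; rewrite lee_fin (le_trans (fC x)) // ger0_norm //.
  by rewrite mulr_ge0 // addr_ge0.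
apply/integrableP; split.
  apply/measurable_EFinP; apply: measurable_funM => //.
  exact: measurable_funD.
under eq_integral => x _.
  rewrite gee0_abs; last by rewrite lee_fin mulr_ge0 // addr_ge0.
  rewrite EFinM EFinD; over.
rewrite ge0_integralZl_EFin //; last 2 first.
- by move=> x _; rewrite -EFinD lee_fin addr_ge0.
- by apply: emeasurable_funD => //; exact: measurable_Ew.
rewrite ge0_integralD //; last 2 first.
- by move=> x _; rewrite lee_fin.
- exact: measurable_Ew.
rewrite integral_prob_cst.
have := w_fin t0; rewrite -ge0_fin_numE ?wmoment_ge0 // => /fineK wE.
by rewrite -[X in (_ + X)%E]wE -EFinD -EFinM ltry.
Qed.

Lemma w_dominated_op f x : w_dominated f -> w_dominated (fun y => f (op x y)).
Proof.
move=> [mf [C C0 fC]]; split.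
  by apply: measurableT_comp mf _; exact: measurable_op2.
exists (C * (1 + K * w x + K)) => [|y].
  by rewrite mulr_ge0 // !addr_ge0 // mulr_ge0.
rewrite (le_trans (fC _)) // -mulrA ler_wpM2l //.
exact: add1_le_mul.
Qed.

Lemma w_dominatedB f g :
  w_dominated f -> w_dominated g -> w_dominated (fun x => f x - g x).
Proof.
move=> [mf [C C0 fC]] [mg [C' C'0 gC]]; split; first exact: measurable_funB.
exists (C + C') => [|x]; first exact: addr_ge0.
by rewrite (le_trans (ler_normB _ _)) // mulrDl lerD.
Qed.

(** The transition operator of the semigroup. *)
Definition conv_op (h : R) (f : V -> R) (x : V) : R :=
  \int[mu h]_y f (op x y).

(** By Tonelli the integral of the absolute value equals that of [|f|] under [mu (s + h)], which is
    finite by domination. *)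
Lemma w_dominated_prod_integrable s h f : 0 <= s -> 0 <= h -> w_dominated f ->
  ((mu s \x mu h)%E).-integrable [set: V * V] (fun z => (f (uop z))%:E).
Proof.
move=> s0 h0 df; have [mf _] := df.
have mfo : measurable_fun [set: V * V] (fun z => (f (uop z))%:E).
  by apply/measurable_EFinP; apply: measurableT_comp mf measurable_op.
apply/integrableP; split => //.
have /integrableP[_] := w_dominated_integrable df (addr_ge0 s0 h0).
apply: le_lt_trans.
rewrite conv_tonelli //; last first.
  by apply: measurableT_comp => //; exact/measurable_EFinP.
rewrite fubini_tonelli1 //.
exact: measurableT_comp.
Qed.

Lemma integrable_conv_op s h f : 0 <= s -> 0 <= h -> w_dominated f ->
  (mu s).-integrable [set: V] (fun x => \int[mu h]_y (f (op x y))%:E)%E.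
Proof.
move=> s0 h0 df.
exact: (integrable_fubini_F (w_dominated_prod_integrable s0 h0 df)).
Qed.

Lemma conv_opE h f x : 0 <= h -> w_dominated f ->
  (conv_op h f x)%:E = (\int[mu h]_y (f (op x y))%:E)%E.
Proof.
move=> h0 df; rewrite /conv_op /Rintegral fineK //.
apply: integrable_fin_num => //.
exact: (w_dominated_integrable (w_dominated_op x df)).
Qed.

Lemma expectation_conv s h f : 0 <= s -> 0 <= h -> w_dominated f ->
  \int[mu (s + h)]_x f x = \int[mu s]_x conv_op h f x.
Proof.
move=> s0 h0 df; have [mf _] := df; congr fine.
under [RHS]eq_integral do rewrite conv_opE //.
rewrite (eq_measure_integral (pushforward (mu s \x mu h)%E uop)); last first.
  by move=> A mA _; exact: mu_conv.
rewrite integral_pushforward //=; last 2 first.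
- exact/measurable_EFinP.
- rewrite preimage_setT; exact: w_dominated_prod_integrable.
rewrite preimage_setT -integral12_prod_meas1 //.
exact: w_dominated_prod_integrable.
Qed.

Lemma w_dominated_conv_op h f : 0 <= h -> w_dominated f ->
  w_dominated (conv_op h f).
Proof.
move=> h0 df; have [mf [C C0 fC]] := df; split.
  apply/measurable_EFinP.
  apply: (eq_measurable_fun (fun x => \int[mu h]_y (f (op x y))%:E)%E).
    by move=> x _; rewrite /= conv_opE.
  (* Only the measurability contained in integrability is wanted; time 0 is an arbitrary choice. *)
  exact: (measurable_int _ (integrable_conv_op (lexx 0) h0 df)).
have dw : w_dominated w.
  by split=> //; exists 1 => // x; rewrite mul1r ger0_norm // lerDr.
pose W := \int[mu h]_y w y.
have W0 : 0 <= W by apply: Rintegral_ge0.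
(* Integrating the growth bound of [f (op x y)] in [y] gives [C (1 + K w x + K W)], from which
   [add1_le_mul] extracts the factor [1 + w x]. *)
exists (C * (1 + K + K * W)) => [|x].
  by rewrite mulr_ge0 // !addr_ge0 // mulr_ge0.
have df' := w_dominated_op x df.
rewrite /conv_op (le_trans (le_normr_Rintegral _ _)) //.
  exact: w_dominated_integrable.
have dg : w_dominated (fun y => C * (1 + K * w x) + C * K * w y).
  split; first by apply: measurable_funD => //; exact: measurable_funM.
  exists (C * (1 + K * w x) + C * K) => [|y].
    by rewrite addr_ge0 // ?mulr_ge0 // addr_ge0 // mulr_ge0.
  rewrite ger0_norm; last first.
    by rewrite addr_ge0 // ?mulr_ge0 // ?addr_ge0 // mulr_ge0.
  rewrite mulrDl lerD //.
    by rewrite ler_peMr ?lerDl // mulr_ge0 // addr_ge0 // mulr_ge0.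
  by rewrite ler_wpM2l ?lerDr // mulr_ge0.
have : \int[mu h]_y `|f (op x y)| <=
       \int[mu h]_y (C * (1 + K * w x) + C * K * w y).
  apply: le_Rintegral => //.
  - apply: (integrable_norm (w_dominated_integrable df' h0)).
  - exact: w_dominated_integrable.
  - move=> y _; rewrite (le_trans (fC _)) // -mulrA -mulrDr ler_wpM2l //.
    by rewrite -addrA lerD2l -mulrDr.
move=> /le_trans; apply.
rewrite RintegralD //; last 2 first.
- by apply: finite_measure_integrable_cst.
- exact: (integrableZl measurableT (C * K) (w_dominated_integrable dw h0)).
rewrite Rintegral_prob_cst.
rewrite RintegralZl //; last exact: (w_dominated_integrable dw).
rewrite -/W -!mulrA -mulrDr ler_wpM2l // -addrA -mulrDr [1 + K + _]addrAC.
by apply: add1_le_mul => //; rewrite addrC.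
Qed.

Notation nneg := [set t : R | 0 <= t].

(** By linearity, differences in [x] commute with integration over the parameter [y]. *)
Lemma fdeg_lt_Rintegral n h (phi : V -> V -> R) :
  (forall x, (mu h).-integrable [set: V] (EFin \o (fun y => phi y x))) ->
  (forall y, fdeg_lt [set: V] op n (phi y)) ->
  fdeg_lt [set: V] op n (fun x => \int[mu h]_y phi y x).
Proof.
elim: n phi => [|n IHn] phi iphi dphi /=.
  by move=> x _; rewrite /Rintegral integral0_eq // => y _; rewrite dphi.
move=> z _; rewrite [X in fdeg_lt _ _ _ X](_ : _ =
    fun x => \int[mu h]_y (phi y (op x z) - phi y x)).
  apply: IHn => [x|y]; last exact: dphi.
  exact: (integrableB measurableT (iphi (op x z)) (iphi x)).
by apply/funext => x; rewrite RintegralB.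
Qed.

(** A time step [h] replaces [f] by [conv_op h f - f]. This is an average of first differences of
    [f], hence of lower degree, and it is still dominated, so the induction goes on. *)
Lemma fdeg_lt_expectation n f : w_dominated f -> fdeg_lt [set: V] op n f ->
  fdeg_lt nneg (fun t h : R => t + h) n (fun t => \int[mu t]_x f x).
Proof.
elim: n f => [|n IHn] f df dgf /=.
  by move=> t t0; rewrite /Rintegral integral0_eq // => y _; rewrite dgf.
move=> h h0; apply: (fdeg_lt_ext (@nneg_add R) _ (IHn
    (fun x => conv_op h f x - f x) _ _)).
- move=> t t0; rewrite (@expectation_conv t h) // RintegralB //.
  + exact: (w_dominated_integrable (w_dominated_conv_op h0 df)).
  + exact: w_dominated_integrable.
- exact: w_dominatedB (w_dominated_conv_op h0 df) df.
rewrite (_ : (fun x => _) = fun x => \int[mu h]_y (f (op x y) - f x)).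
  apply: (@fdeg_lt_Rintegral n h (fun y x => f (op x y) - f x)) => [x|y].
    exact: (integrableB measurableT
      (w_dominated_integrable (w_dominated_op x df) h0)
      (finite_measure_integrable_cst (mu h) (f x) measurableT)).
  exact: dgf.
apply/funext => x; rewrite RintegralB //; last 2 first.
- exact: (w_dominated_integrable (w_dominated_op x df)).
- exact: finite_measure_integrable_cst.
by rewrite Rintegral_prob_cst.
Qed.

End polynomial_moments.

Local Open Scope ring_scope.

(** Local boundedness is used twice: it makes all moments finite, so that the degree of [w] passes
    to its expectation, and it is the regularity required by [frechet_polynomial]. *)
Lemma wmoment_polynomial n (B : set V) (delta : R) : measurable B ->
  (forall x y, B y -> w x <= K * (w (op x y) + 1)) -> 0 < delta ->
  (forall h : R, 0 <= h <= delta -> ((2^-1)%:E <= mu h B)%E) ->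
  fdeg_lt [set: V] op n w -> (wmoment 1 < +oo)%E ->
  exists2 p : {poly R}, (size p <= n)%N &
    forall t, 0 <= t -> wmoment t = (p.[t])%:E.
Proof.
move=> mB wB d0 muB dw W1.
have Wb := wmoment_locally_bounded mB wB d0 muB W1.
have Wfin (t : R) : 0 <= t -> (wmoment t < +oo)%E.
  move=> t0; have [C WC] := Wb t; apply: le_lt_trans (ltry C).
  by apply: WC; rewrite t0 lexx.
have wd : w_dominated w.
  by split=> //; exists 1 => // x; rewrite mul1r ger0_norm // lerDr.
have WE (t : R) : 0 <= t -> wmoment t = (\int[mu t]_x w x)%:E.
  by move=> t0; rewrite /Rintegral fineK // ge0_fin_numE ?wmoment_ge0 // Wfin.
have [|p pn pE] := frechet_polynomial (fdeg_lt_expectation Wfin wd dw).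
  move=> M; have [C WC] := Wb M; exists C => t tM.
  rewrite ger0_norm; last by apply: Rintegral_ge0.
  by rewrite -lee_fin -WE ?WC //; case/andP: tM.
by exists p => // t t0; rewrite WE // pE.
Qed.

End convolution_semigroup.

(** * Levy processes *)

Lemma le_measure_ae d (T : measurableType d) (R : realType)
    (P : {measure set T -> \bar R}) (A B : set T) :
  measurable A -> measurable B -> {ae P, forall w, A w -> B w} ->
  (P A <= P B)%E.
Proof.
move=> mA mB AB.
have mD : measurable (A `\` B) by exact: measurableD.
have D0 : P (A `\` B) = 0%E.
  apply: measure_negligible => //; apply: negligibleS AB => w [Aw nBw] /=.
  by move=> /(_ Aw).
rewrite -[X in (_ <= X)%E]adde0 -D0.
apply: (@le_trans _ _ (P (B `|` (A `\` B)))); last exact: measureU2.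
apply: le_measure; rewrite ?inE //; first exact: measurableU.
by move=> w Aw; case: (pselect (B w)) => Bw; [left|right].
Qed.

Lemma eq_measure_ae d (T : measurableType d) (R : realType)
    (P : {measure set T -> \bar R}) (A B : set T) :
  measurable A -> measurable B -> {ae P, forall w, A w <-> B w} -> P A = P B.
Proof.
move=> mA mB AB; apply/eqP; rewrite eq_le; apply/andP; split;
  by apply: le_measure_ae => //; apply: filterS AB => w [].
Qed.

Lemma image_probability d d' (T : measurableType d) (T' : measurableType d')
    (R : realType) (P : probability T R) (X : T -> T') :
  measurable_fun [set: T] X ->
  exists Q : probability T' R, forall A, Q A = P (X @^-1` A).
Proof.
move=> mX; pose X' : {mfun T >-> T'} :=
  HB.pack X (isMeasurableFun.Build _ _ _ _ _ mX).
by exists (distribution P X').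
Qed.

(** The bound on [c] is at most four times the larger of [a] and [b]. This is the source of the
    constant [K = 4 ^+ q]. *)
Lemma expr_le_sum (R : realFieldType) (a b c : R) q :
  0 <= a -> 0 <= b -> 0 <= c -> c <= 2 * a + 2 * b ->
  c ^+ q <= 4 ^+ q * (a ^+ q + b ^+ q).
Proof.
move=> a0 b0 c0 cab.
have [ab|/ltW ba] := leP a b.
  apply: (@le_trans _ _ ((4 * b) ^+ q)).
    by rewrite lerXn2r ?nnegrE ?mulr_ge0 // (le_trans cab) //; lra.
  by rewrite exprMn ler_wpM2l ?exprn_ge0 // lerDr exprn_ge0.
apply: (@le_trans _ _ ((4 * a) ^+ q)).
  by rewrite lerXn2r ?nnegrE ?mulr_ge0 // (le_trans cab) //; lra.
by rewrite exprMn ler_wpM2l ?exprn_ge0 // lerDl exprn_ge0.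
Qed.

(** A coordinate is additive, so its first differences are constants; squaring doubles the
    degree. *)
Lemma fdeg_lt_sqnorm (R : realType) m :
  fdeg_lt [set: 'rV[R]_m] (fun x y => x + y) 3 (@sqnorm R m).
Proof.
apply: fdeg_lt_sum => // i.
apply: (@fdeg_lt_exp _ _ _ _ _ 1 _ 2) => //.
move=> h _ ; apply: (fdeg_lt_ext _ _ (@fdeg_lt_cst R _ _ _ (h 0 i))) => //.
by move=> x _; rewrite mxE addrAC subrr add0r.
Qed.

Lemma measurable_unit_ball (R : realType) m :
  measurable ([set x | sqnorm x <= 1] : set (borel_rV R m)).
Proof.
rewrite -[X in measurable X]setTI.
rewrite -[X in _ `&` X](_ : sqnorm @^-1` `]-oo, 1%R] = _).
  by apply: measurable_sqnorm => //; exact: measurable_itv.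
by apply/seteqP; split=> x; rewrite /preimage /= in_itv.
Qed.

Lemma powR_le_add1 (R : realType) (u r : R) :
  0 <= u -> 0 <= r <= 1 -> u `^ r <= 1 + u.
Proof.
move=> u0 /andP[r0 r1]; have [u1|/ltW u1] := leP u 1.
  apply: (@le_trans _ _ 1); last by rewrite lerDl.
  by rewrite -[leRHS]/((fun=> 1) r) -powR1 ge0_ler_powR ?nnegrE.
by rewrite (le_trans (ler1_powR u1 r1)) // lerDr.
Qed.

(** With [u = a^n / h] one has [a^k = h^(k/n) u^(k/n)], and the exponent [k/n] is at most 1. The
    bracket has bounded expectation once the [n]-th moment is of order [h]. *)
Lemma powR_le_scaled (R : realType) (a h k : R) n :
  0 <= a -> 0 < h -> 0 < k -> k <= n%:R ->
  a `^ k <= h `^ (k / n%:R) * (1 + a `^ n%:R / h).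
Proof.
move=> a0 h0 k0 kn; have n0 : 0 < n%:R :> R by exact: lt_le_trans kn.
pose u := a `^ n%:R / h; have u0 : 0 <= u by rewrite divr_ge0 ?powR_ge0 // ltW.
have -> : a `^ k = (h * u) `^ (k / n%:R).
  rewrite /u mulrC divfK ?gt_eqF // -powRrM mulrC divfK ?gt_eqF //.
rewrite powRM ?(ltW h0) // ler_wpM2l ?powR_ge0 // powR_le_add1 //.
by rewrite divr_ge0 ?(ltW k0) ?(ltW n0) //= ler_pdivrMr // mul1r.
Qed.

Lemma enorm_gt1 (R : realType) m (x : 'rV[R]_m) :
  (1 < enorm x) = ~~ (sqnorm x <= 1).
Proof. by rewrite ltNge -[X in _ <= X]sqrtr1 ler_sqrt. Qed.

(** * Independence, marginal laws and small increments *)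

Section levy.
Context {R : realType} {d : measure_display} {T : measurableType d}.
Context {P : probability T R} {m : nat} {L : R -> T -> 'rV[R]_m}.
Hypothesis hL : levy_process P L.

Lemma measurable_random_vector (X : T -> 'rV[R]_m) (A : set (borel_rV R m)) :
  random_vector X -> measurable A -> measurable (X @^-1` A).
Proof. by move=> mX mA; rewrite -[X in measurable X]setTI; apply: mX. Qed.

Lemma measurable_levy_incr s t : 0 <= s -> 0 <= t ->
  random_vector (fun w => L t w - L s w).
Proof.
by move=> s0 t0; apply: measurable_subV; apply: (levy_random_vector hL).
Qed.

Lemma levy_law_incr0 t (A : set (borel_rV R m)) : 0 <= t -> measurable A ->
  P ((fun w => L t w - L 0 w) @^-1` A) = P (L t @^-1` A).
Proof.
move=> t0 mA; apply: eq_measure_ae.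
- by apply: measurable_random_vector => //; exact: measurable_levy_incr.
- by apply: measurable_random_vector => //; exact: (levy_random_vector hL).
- apply: filterS (levy_start hL) => w L0.
  by rewrite /preimage /= L0 subr0.
Qed.

(** Almost surely [L s] is the increment from time 0, so independence of two consecutive increments
    applies; stationarity turns the second law into that of [L h]. *)
Lemma levy_indep s h (A B : set (borel_rV R m)) : 0 <= s -> 0 <= h ->
  measurable A -> measurable B ->
  P (L s @^-1` A `&` (fun w => L (s + h) w - L s w) @^-1` B) =
  (P (L s @^-1` A) * P (L h @^-1` B))%E.
Proof.
move=> s0 h0 mA mB; have sh0 : 0 <= s + h by exact: addr_ge0.
have mLs := levy_random_vector hL s0.
have mI := measurable_levy_incr s0 sh0.
have mI0 := measurable_levy_incr (lexx 0) s0.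
(* The subdivision 0, [s], [s + h], constant afterwards. *)
pose t (i : nat) : R := if i is j.+1 then if j is 0%N then s else s + h else 0.
pose AB (i : 'I_2) : set (borel_rV R m) := if i == ord0 then A else B.
have := @levy_independent_increments _ _ _ _ _ _ hL 2 t (lexx 0).
have -> : (forall i, (i < 2)%N -> t i <= t i.+1) = True.
  by apply/propext; split=> // _ [|[|]] //= _; rewrite lerDl.
move=> /(_ I AB) HI.
have {HI} := HI _.
rewrite !big_ord_recl big_ord0 mule1 /AB /=.
rewrite (levy_law_incr0 s0 mA).
have -> : P ((fun w => L (s + h) w - L s w) @^-1` B) = P (L h @^-1` B).
  rewrite -(levy_law_incr0 h0 mB).
  have := @levy_stationary_increments _ _ _ _ _ _ hL s 0 h s0 (lexx 0) h0 B mB.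
  by rewrite add0r.
move=> <-; last by move=> i; case: ifP.
apply: eq_measure_ae.
- by apply: measurableI; exact: measurable_random_vector.
- apply: fin_bigcap_measurable => // i _.
  apply: measurable_random_vector; last by rewrite /AB; case: ifP.
  by apply: measurable_levy_incr; case: i => [[|[|]]].
apply: filterS (levy_start hL) => w L0; split.
  move=> [Aw Bw] i _; case: i => [[|[|]] //= ?]; rewrite /preimage /= /AB.
  by rewrite L0 subr0.
move=> H; split.
  by have := H ord0 I; rewrite /preimage /= L0 subr0.
by have := H (lift ord0 ord0) I.
Qed.

Lemma levy_laws : exists mu : R -> probability (borel_rV R m) R,
  forall t, 0 <= t -> forall A, mu t A = P (L t @^-1` A).
Proof.
have /choice[mu muE] : forall t, exists Q : probability (borel_rV R m) R,
    0 <= t -> forall A, Q A = P (L t @^-1` A).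
  move=> t; have [t0|t0] := leP 0 t.
    have [Q QE] := image_probability P (levy_random_vector hL t0).
    by exists Q.
  (* At negative times the law of [L 0] serves as a default. *)
  have [Q _] := image_probability P (levy_random_vector hL (lexx 0)).
  by exists Q.
by exists mu.
Qed.

(** The joint law of [L s] and the next increment agrees with the product measure on rectangles,
    hence everywhere; its image under addition is the law of [L (s + h)]. *)
Lemma levy_law_conv (mu : R -> probability (borel_rV R m) R) :
  (forall t, 0 <= t -> forall A, mu t A = P (L t @^-1` A)) ->
  forall s h : R, 0 <= s -> 0 <= h ->
  forall A : set (borel_rV R m), measurable A ->
  mu (s + h) A = ((mu s \x mu h)%E)
    ((fun z : borel_rV R m * borel_rV R m =>
        (z.1 + z.2 : 'rV[R]_m) : borel_rV R m) @^-1` A).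
Proof.
move=> muE s h s0 h0 A mA; have sh0 := addr_ge0 s0 h0.
pose X w : borel_rV R m * borel_rV R m := (L s w, L (s + h) w - L s w).
have mX : measurable_fun [set: T] X.
  apply: measurable_fun_pair; first exact: (levy_random_vector hL).
  exact: measurable_levy_incr.
have [Q QE] := image_probability P mX.
rewrite (@product_measure_unique _ _ _ _ _ (mu s) (mu h) Q).
- apply/esym; apply: etrans (QE _) _; rewrite muE //; congr (P _).
  by apply/funext => w; rewrite /preimage /= [_ + _]addrC subrK.
- move=> B C mB mC.
  apply: etrans (QE _) _; apply: etrans (levy_indep s0 h0 mB mC) _.
  by congr (_ * _)%E; apply/esym/muE.
- by rewrite -[X in measurable X]setTI; exact: measurable_addV.
Qed.

Lemma levy_small_ball : exists2 delta : R, 0 < delta &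
  forall h, 0 <= h <= delta ->
    ((2^-1)%:E <= P (L h @^-1` [set x | (sqnorm x <= 1)%R]))%E.
Proof.
have half0 : (0 < (2^-1)%:E :> \bar R)%E by rewrite lte_fin invr_gt0.
have := levy_continuous_in_probability hL (lexx 0) (@ltr01 R).
move=> /(_ _ (open_ereal_lt' half0)).
rewrite /= /within /= => /nbhs_ballP[e /= e0 eP].
(* Halving [e] puts the closed range [h <= delta] inside the open ball. *)
exists (e / 2); rewrite ?divr_gt0 // => h /andP[h0 he].
have mB := @measurable_unit_ball R m.
rewrite -levy_law_incr0 //.
set E := _ @^-1` _.
have mE : measurable E.
  by apply: measurable_random_vector mB; exact: measurable_levy_incr.
have -> : E = ~` (~` E) by rewrite setCK.
rewrite probability_setC; last exact: measurableC.
have : (P (~` E) < (2^-1)%:E)%E.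
  suff -> : ~` E = [set w | 1 < enorm (L h w - L 0 w)].
    apply: eP; last by rewrite /= in_itv /= andbT.
    rewrite /ball /= sub0r normrN ger0_norm //.
    by rewrite (le_lt_trans he) // ltr_pdivrMr // mulr_natr mulr2n ltrDl.
  by apply/seteqP; split=> w; rewrite /E /preimage /= enorm_gt1 => /negP.
rewrite -(fineK (fin_num_measure P _ (measurableC mE))) -EFinB !lte_fin lee_fin.
lra.
Qed.

(** * Moments of the process *)

Lemma norm_moment_double (X : T -> 'rV[R]_m) q :
  norm_moment P X (q.*2)%:R = (\int[P]_w (sqnorm (X w) ^+ q)%:E)%E.
Proof.
rewrite /norm_moment unlock; apply: eq_integral => w _.
rewrite powR_mulrn ?sqrtr_ge0 // -mul2n exprM sqr_sqrtr //.
exact: sqnorm_ge0.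
Qed.

(** The semigroup result is applied with weight [sqnorm x ^+ q] and [B] the closed unit ball; the
    weight has degree [2q], whence [2q + 1] differences. *)
Lemma levy_even_moment q :
  (norm_moment P (L 1) (q.*2)%:R < +oo)%E ->
  exists2 p : {poly R}, (size p <= q.*2.+1)%N &
    forall t, 0 <= t -> norm_moment P (L t) (q.*2)%:R = (p.[t])%:E.
Proof.
have [mu muE] := levy_laws.
pose w (x : borel_rV R m) : R := sqnorm x ^+ q.
have mw : measurable_fun [set: borel_rV R m] w.
  by apply: measurable_funX; exact: measurable_sqnorm.
have w0 x : 0 <= w x by rewrite exprn_ge0 // sqnorm_ge0.
have wmE t : 0 <= t -> wmoment mu w t = norm_moment P (L t) (q.*2)%:R.
  move=> t0; have mL := levy_random_vector hL t0.
  rewrite /wmoment norm_moment_double.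
  rewrite (eq_measure_integral (pushforward P (L t : T -> borel_rV R m))).
    rewrite ge0_integral_pushforward //.
    - exact/measurable_EFinP.
    - by move=> x _; rewrite lee_fin.
  by move=> A mA _; apply: muE.
have [delta d0 smallB] := levy_small_ball.
rewrite -wmE // => W1.
have mB := @measurable_unit_ball R m.
have [|||||||p pn pE] := @wmoment_polynomial R _ (borel_rV R m)
  (fun x y => (x + y : 'rV[R]_m)) mu w (4 ^+ q) _ _ mw w0 _ _ (q.*2.+1)
  [set x | sqnorm x <= 1] delta mB _ d0 _ _ W1.
- exact: measurable_addV.
- exact: levy_law_conv.
- by [].
- by move=> x y; apply: expr_le_sum; rewrite ?sqnorm_ge0 // sqnorm_add.
(* Reading 1 as [1 ^+ q] makes this an instance of [expr_le_sum] with [b = 1]. *)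
- move=> x y /= y1; rewrite -[X in _ + X](expr1n _ q).
  apply: expr_le_sum; rewrite ?sqnorm_ge0 //.
  by rewrite (le_trans (sqnorm_sub x y)) // lerD2l ler_wpM2l.
- by move=> h hd; rewrite muE ?smallB //; case/andP: hd.
- rewrite -mul2n.
  apply: (@fdeg_lt_exp _ _ _ _ _ 2 _ q) => //.
  exact: fdeg_lt_sqnorm.
by exists p => // t t0; rewrite -wmE // pE.
Qed.

Lemma measurable_enorm_powR (X : T -> 'rV[R]_m) r :
  random_vector X -> measurable_fun [set: T] (fun w => enorm (X w) `^ r).
Proof.
move=> mX; apply: measurableT_comp (measurable_powR r) _.
apply: (eq_measurable_fun (fun w => sqnorm (X w) `^ 2^-1)) => [w _|].
  by rewrite powR12_sqrt // sqnorm_ge0.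
apply: measurableT_comp (measurable_powR _) _.
exact: measurableT_comp (@measurable_sqnorm R m) mX.
Qed.

(** Positivity of [k] matters, since [powR 0 0] is 1. *)
Lemma norm_moment0 k : 0 < k -> norm_moment P (L 0) k = 0%E.
Proof.
move=> k0; rewrite /norm_moment unlock.
rewrite (@ae_eq_integral _ _ _ _ _ (cst 0%E)) ?integral0 //.
- exact/measurable_EFinP/measurable_enorm_powR/(levy_random_vector hL).
- apply: filterS (levy_start hL) => w L0 _ /=; rewrite L0.
  rewrite (_ : enorm 0 = 0) ?powR0 ?gt_eqF //.
  by rewrite /enorm big1 ?sqrtr0 // => i _; rewrite mxE expr0n.
Qed.

Lemma levy_even_moment_polynomial n : ~~ odd n -> (0 < n)%N ->
  (norm_moment P (L 1) n%:R < +oo)%E ->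
  exists c : nat -> R, forall t : R, 0 <= t ->
    norm_moment P (L t) n%:R = (\sum_(1 <= i < n.+1) c i * t ^+ i)%:E.
Proof.
move=> on n0; rewrite -(even_halfK on).
set q := n./2 => W1; have [p pn pE] := levy_even_moment W1.
exists (fun i => p`_i) => t t0; rewrite pE // (horner_coef_wide _ pn).
(* The constant term is the moment at time 0, so the sum may start at index 1. *)
have p0 : p`_0 = 0.
  apply: EFin_inj; rewrite -horner_coef0 -pE // norm_moment0 //.
  by rewrite ltr0n /q even_halfK.
rewrite -(big_mkord xpredT (fun i => p`_i * t ^+ i)) big_nat_recl //.
by rewrite p0 mul0r add0r big_add1.
Qed.

Lemma levy_moment_bigO n (k : R) : ~~ odd n -> 0 < k -> k <= n%:R ->
  (norm_moment P (L 1) n%:R < +oo)%E ->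
  bigO_unit (fun h => norm_moment P (L h) k) (fun h => h `^ (k / n%:R)).
Proof.
move=> on k0 kn W1; have n0 : 0 < n%:R :> R by exact: lt_le_trans kn.
have [c cE] := levy_even_moment_polynomial on (etrans (esym (ltr0n R n)) n0) W1.
(* For [h] in (0, 1) and [i >= 1] the power [h ^+ i] is at most [h], so the [n]-th moment divided by
   [h] is at most the sum of the [|c i|]; the 1 comes from [powR_le_scaled]. *)
exists (1 + \sum_(1 <= i < n.+1) `|c i|) => h /andP[h0 h1].
have mL := levy_random_vector hL (ltW h0).
have mp r : measurable_fun [set: T] (fun w => (enorm (L h w) `^ r)%:E).
  exact/measurable_EFinP/measurable_enorm_powR.
rewrite gee0_abs; last first.
  rewrite /norm_moment unlock; apply: integral_ge0 => w _.
  by rewrite lee_fin powR_ge0.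
apply: (@le_trans _ _ (\int[P]_w ((h `^ (k / n%:R))%:E *
    (1 + (h^-1)%:E * (enorm (L h w) `^ n%:R)%:E))))%E.
  rewrite /norm_moment unlock; apply: ge0_le_integral => //.
  - by move=> w _; rewrite lee_fin powR_ge0.
  - apply: measurable_funeM; apply: emeasurable_funD => //.
    exact: measurable_funeM.
  - move=> w _; rewrite -!EFinM lee_fin [h^-1 * _]mulrC.
    by rewrite powR_le_scaled // sqrtr_ge0.
rewrite ge0_integralZl_EFin ?powR_ge0 //; last 2 first.
- move=> w _; rewrite -EFinM lee_fin addr_ge0 // mulr_ge0 ?powR_ge0 //.
  by rewrite invr_ge0 ltW.
- by apply: emeasurable_funD => //; exact: measurable_funeM.
rewrite ge0_integralD //; last 2 first.
- move=> w _; rewrite -EFinM lee_fin mulr_ge0 ?powR_ge0 //.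
  by rewrite invr_ge0 ltW.
- exact: measurable_funeM.
rewrite integral_prob_cst.
rewrite ge0_integralZl_EFin ?invr_ge0 ?(ltW h0) //; last first.
  by move=> w _; rewrite lee_fin powR_ge0.
have := cE h (ltW h0); rewrite {1}/norm_moment unlock => ->.
rewrite -!EFinM lee_fin mulrC ler_wpM2r ?powR_ge0 // lerD2l.
rewrite ler_pdivrMl // mulr_sumr !big_seq; apply: ler_sum => i.
rewrite mem_index_iota => /andP[i1 _]; rewrite (le_trans (ler_norm _)) //.
rewrite normrM mulrC ler_wpM2r // normrX ger0_norm ?(ltW h0) //.
by rewrite -[i]prednK // exprS ler_piMr ?(ltW h0) // exprn_ile1 ?ltW.
Qed.

End levy.

Theorem proposition2p3 (R : realType) (d : measure_display)
    (T : measurableType d) (P : probability T R) (m : nat) (k : R)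
    (L : R -> T -> 'rV[R]_m) (hk : 0 < k) (hL : levy_process P L) :
  (forall n : nat, ~~ odd n -> k = n%:R ->
     (norm_moment P (L 1%R) k < +oo)%E ->
     exists c : nat -> R, forall t : R, 0 <= t ->
       norm_moment P (L t) k = (\sum_(1 <= i < n.+1) c i * t ^+ i)%:E) /\
  ((norm_moment P (L 1%R) (even_ceil k)%:R < +oo)%E ->
     bigO_unit (fun h => norm_moment P (L h) k)
               (fun h => h `^ (k / (even_ceil k)%:R))).
Proof.
split=> [n on kn|].
  move: hk; rewrite kn ltr0n => n0.
  exact: levy_even_moment_polynomial.
rewrite /even_ceil; case: ex_minnP => n /andP[on kn] _.
exact: levy_moment_bigO.
Qed.
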